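(* Let $\Omega,\mathcal{C}$ be closed, convex sets in $\mathbb{R}^d$ with nonempty interior, and $\mathcal{C}\subseteq\Omega$. Assume $f:\Omega\to\mathbb{R}$ is convex on $\mathcal{C}$, and $L$-smooth with respect to a norm $\|\cdot\|$ on $\mathcal{C}\cap\mathrm{int}(\Omega)$, for $L>0$. Assume $\phi:\Omega\to\mathbb{R}$ is of Legendre type, and $\alpha$-strongly convex with respect to $\|\cdot\|$ on $\Omega$, for $\alpha>0$. Consider the mirror descent iterates $$\theta_{t+1}=\arg\min_{\theta\in\mathcal{C}}\Big(\eta_t\langle\nabla f(\theta_t),\theta\rangle+D_\phi(\theta,\theta_t)\Big),$$ initialized at $\theta_0\in\mathcal{C}\cap\mathrm{int}(\Omega)$, with step sizes $\eta_t\in(0,\alpha/L]$, $t=0,1,2,\dots$. The following holds. 1. (Objective convergence.) Let $f^\star=\inf_{\theta\in\mathcal{C}}f(\theta)\in[-\infty,\infty)$. If $\sum_{t=0}^\infty\eta_t=\infty$, then $\lim_{t\to\infty}f(\theta_t)=f^\star$. 2. (Nonincreasing distance to solution set.) Define the solution set $S=\{\theta\in\mathcal{C}:f(\theta)=f^\star\}$. Notice that $S$ is closed and convex. If $S\ne\emptyset$, then $\{D_\phi(s,\theta_t)\}_{t=0}^\infty$ is nonincreasing for any $s\in S$, and thus $\{\mathrm{dist}^\phi_S(\theta_t)\}_{t=0}^\infty$ is nonincreasing. 3. (Iterate convergence.) Suppose $S\ne\emptyset$ and $\sum_{t=0}^\infty\eta_t=\infty$. If either $S\cap\mathrm{int}(\Omega)\ne\emptyset$,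 or $D_\phi$ is continuous in its second argument relative to $\mathrm{int}(\Omega)$, then $\lim_{t\to\infty}\theta_t=\theta_\infty\in S$ (the limit exists and lies in $S$). 4. (Minimum Bregman divergence solution.) If $S\ne\emptyset$, $\sum_{t=0}^\infty\eta_t=\infty$, and $S$ is affine with $S\subseteq\mathrm{int}(\Omega)$, then $\theta_\infty=\Pi^\phi_S(\theta_0)$, where $\theta_\infty=\lim_{t\to\infty}\theta_t$.
   Context: $\mathrm{int}(\Omega)$ is the interior of $\Omega$ (relative interior when $\Omega$ is not full-dimensional) and $\partial\Omega$ its boundary. The Bregman divergence of a convex $\phi$, differentiable on $\mathrm{int}(\Omega)$, is $D_\phi(u,v)=\phi(u)-\phi(v)-\langle\nabla\phi(v),u-v\rangle$, for $u\in\Omega$, $v\in\mathrm{int}(\Omega)$. $\Pi^\phi_S(u)=\arg\min_{s\in S}D_\phi(s,u)$ is the Bregman projection of $u$ onto $S$, and $\mathrm{dist}^\phi_S(u)=\min_{s\in S}D_\phi(s,u)$ is the Bregman distance from $u$ to $S$. ''$D_\phi$ is continuous in its second argument relative to $\mathrm{int}(\Omega)$'' means: for every sequence $\{y_k\}_{k=1}^\infty\subseteq\mathrm{int}(\Omega)$ such that $y_k\to y$, we have $D_\phi(y,y_k)\to0$. $\phi$ is of Legendre type if it is essentially smooth and essentially strictly convex. Essentially smooth: $\mathrm{int}(\Omega)\ne\emptyset$, $\phi$ is differentiable on $\mathrm{int}(\Omega)$, and $\|\nabla\phi(x_k)\|_2\to\infty$ for any sequence $\{x_k\}\subset\mathrm{int}(\Omega)$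 converging to a point of $\partial\Omega$. Essentially strictly convex: strictly convex on every convex subset of $\{x\in\Omega:\partial\phi(x)\neq\emptyset\}$, where $\partial\phi(x)$ is the subdifferential. $\phi$ is $\alpha$-strongly convex with respect to $\|\cdot\|$ if $\phi(y)\ge\phi(x)+\langle\nabla\phi(x),y-x\rangle+\frac{\alpha}{2}\|x-y\|^2$ for all $y\in\Omega$ and $x\in\mathrm{int}(\Omega)$. $f$ is $L$-smooth with respect to $\|\cdot\|$ on a set if it is differentiable there and $\|\nabla f(x)-\nabla f(y)\|_*\le L\|x-y\|$ for all $x,y$ in the set, where $\|\cdot\|_*$ is the dual norm.
   Formalization: The claim that S is closed (part 2), and iterate convergence (part 3) under continuity of D_φ in its second argument, are proved assuming in addition that f is lower semicontinuous on C; without this both fail, as f may jump up on the boundary of Ω. *)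

(* Defs.v *)
(* R^d is represented by the row vectors 'rV[R]_d, R : realType. *)
From HB Require Import structures.
From mathcomp Require Import all_boot all_order all_algebra.
From mathcomp Require Import all_classical all_reals all_analysis.

Set Implicit Arguments.
Unset Strict Implicit.
Unset Printing Implicit Defensive.

Import Order.TTheory GRing.Theory Num.Theory.
Import numFieldNormedType.Exports.

Local Open Scope classical_set_scope.
Local Open Scope ring_scope.

(* A function on a set D of R^d is a total function 'rV[R]_d -> R whose values
   outside D are never used: derivatives are only taken at interior points
   of D, where they do not depend on these values. *)
Section MirrorDescent.
Context {R : realType} {d : nat}.
Local Notation V := 'rV[R]_d.
Implicit Types (f phi N : V -> R) (x y u v g : V) (A C S Omega : set V).

Definition dot u v : R := \sum_(i < d) u ord0 i * v ord0 i.

Definition norm2 u : R := Num.sqrt (dot u u).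

(* The ambient norm of 'rV[R]_d is the sup norm; being equivalent to every
   other norm on R^d, it is only used for its topology. *)
Definition is_norm N : Prop :=
  [/\ forall x, N x = 0 -> x = 0,
      forall (a : R) x, N (a *: x) = `|a| * N x &
      forall x y, N (x + y) <= N x + N y].

Definition dual_norm N g : R := sup [set dot g x | x in [set x | N x <= 1]].

Definition grad f x : V := \row_(i < d) 'D_(delta_mx ord0 i) f x.

Definition boundary A : set V := closure A `\` A°.

Definition bregman phi u v : R := phi u - phi v - dot (grad phi v) (u - v).

Definition argmin A (F : V -> R) : set V :=
  [set x | A x /\ forall y, A y -> F x <= F y].

Definition bregman_proj phi S u : set V := argmin S (fun s => bregman phi s u).

(* An infimum, hence total: the minimum whenever it is attained. *)
Definition bregman_dist phi S u : R := inf [set bregman phi s u | s in S].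

Definition bregman_continuous_snd Omega phi : Prop :=
  forall (y : V) (y_ : nat -> V), (forall k, Omega° (y_ k)) ->
    y_ k @[k --> \oo] --> y -> bregman phi y (y_ k) @[k --> \oo] --> (0 : R).

Definition subdifferential Omega phi x : set V :=
  [set g | forall y, Omega y -> phi x + dot g (y - x) <= phi y].

Definition strictly_convex_on A phi : Prop :=
  forall x y (t : R), A x -> A y -> x != y -> 0 < t < 1 ->
    phi (t *: x + (1 - t) *: y) < t * phi x + (1 - t) * phi y.

Definition essentially_smooth Omega phi : Prop :=
  [/\ Omega° !=set0,
      forall x, Omega° x -> differentiable phi x &
      forall (x : V) (x_ : nat -> V), (forall k, Omega° (x_ k)) ->
        boundary Omega x -> x_ k @[k --> \oo] --> x ->
        norm2 (grad phi (x_ k)) @[k --> \oo] --> +oo].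

Definition essentially_strictly_convex Omega phi : Prop :=
  forall A, convex_set A ->
    A `<=` [set x | Omega x /\ subdifferential Omega phi x !=set0] ->
    strictly_convex_on A phi.

Definition legendre Omega phi : Prop :=
  [/\ convex_function Omega phi,
      essentially_smooth Omega phi &
      essentially_strictly_convex Omega phi].

Definition strongly_convex N (alpha : R) Omega phi : Prop :=
  forall x y, Omega° x -> Omega y ->
    phi x + dot (grad phi x) (y - x) + alpha / 2 * N (x - y) ^+ 2 <= phi y.

Definition smooth N (L : R) A f : Prop :=
  (forall x, A x -> differentiable f x) /\
  (forall x y, A x -> A y -> dual_norm N (grad f x - grad f y) <= L * N (x - y)).

Definition mirror_descent C f phi (eta : nat -> R) (theta : nat -> V) : Prop :=
  forall t, argmin C
    (fun x => eta t * dot (grad f (theta t)) x + bregman phi x (theta t))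
    (theta t.+1).

Definition optimal_value C f : \bar R := ereal_inf [set (f x)%:E | x in C].

Definition solution_set C f : set V :=
  [set x | C x /\ (f x)%:E = optimal_value C f].

(* f restricted to C is closed (lower semicontinuous) in the sense of convex
   analysis: its extension by +oo outside C is lower semicontinuous. *)
Definition closed_on C f : Prop :=
  lower_semicontinuous (patch (cst +oo%E) C (EFin \o f)).

Definition affine_set S : Prop :=
  forall x y (t : R), S x -> S y -> S (t *: x + (1 - t) *: y).

End MirrorDescent.

(* Main.v *)
Require Import Defs.
From HB Require Import structures.
From mathcomp Require Import all_boot all_order all_algebra.
From mathcomp Require Import all_classical all_reals all_analysis.
From mathcomp Require Import lra.

(** One inequality carries the four conclusions: for every [u] in [C],
      [eta t * (f (theta t.+1) - f u) <= D u (theta t) - D u (theta t.+1)],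
    where [D] is the Bregman divergence of [phi] ([mirror_descent_step]).  It
    combines the first-order optimality of [theta t.+1], rewritten with the
    three-point identity of [D], with the descent lemma for the [L]-smooth [f]
    and the gradient inequality for the convex [f]; the quadratic error term
    [L / 2 * N (theta t.+1 - theta t) ^+ 2] is absorbed by
    [D (theta t.+1) (theta t)] thanks to the strong convexity of [phi] and to
    [eta t <= alpha / L].

    - With [u = theta t] it says that the objective does not increase; summed
      over [t] it bounds [f (theta T) - f u] by [D u (theta 0)] divided by the
      sum of the step sizes.  Hence the convergence of the objective.
    - With [u] a solution its left-hand side is nonnegative, so that
      [D u (theta t)] does not increase.  By strong convexity the iterates are
      then bounded, hence accumulate at some point [p] of [C].  If [p] is a
      solution and [D p] tends to 0 along a subsequence, then it tends to 0
      along the whole sequence because it is monotone, and the iterates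
      converge to [p].
    - If the solution set is affine, [D u (theta t) - D u (theta 0)], which is
      an affine function of [u], is nonpositive on an affine set, hence
      constant there.  So all solutions keep the same gap between their
      divergences to [theta t]; letting [t] go to infinity shows that the limit
      has the least divergence to [theta 0].

    The iterates must be interior to [Omega] for their divergences to make
    sense, and an interior solution must force their limit to be interior, where
    [f] and [phi] are continuous.  Both facts come from one lemma on essentially
    smooth functions, [bregman_bounded_limit_interior]: if [w] is interior and
    [D w] stays bounded along a sequence of interior points, the sequence cannot
    converge to the boundary, since the bound on [D w] bounds the gradients.  It
    is applied to points that approach [theta t.+1] along a segment, with [w] in
    the interior of [C], and to a subsequence of the iterates, with [w] an
    interior solution. *)

Import Order.TTheory GRing.Theory Num.Theory.
Import numFieldNormedType.Exports.
Local Open Scope classical_set_scope.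
Local Open Scope ring_scope.

Set Implicit Arguments.
Unset Strict Implicit.

(** * Dot product and norms on row vectors *)

Section DotProduct.
Context {R : realType} {d : nat}.
Implicit Types (u v w : 'rV[R]_d) (a : R).

Lemma dotC u v : dot u v = dot v u.
Proof. by apply: eq_bigr => i _; rewrite mulrC. Qed.

Lemma dotDr u v w : dot u (v + w) = dot u v + dot u w.
Proof. by rewrite /dot -big_split; apply: eq_bigr => i _; rewrite !mxE mulrDr. Qed.

Lemma dotZr a u v : dot u (a *: v) = a * dot u v.
Proof. by rewrite /dot mulr_sumr; apply: eq_bigr => i _; rewrite !mxE mulrCA. Qed.

Lemma dotNr u v : dot u (- v) = - dot u v.
Proof. by rewrite -scaleN1r dotZr mulN1r. Qed.

Lemma dotBr u v w : dot u (v - w) = dot u v - dot u w.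
Proof. by rewrite dotDr dotNr. Qed.

Lemma dotBl u v w : dot (u - v) w = dot u w - dot v w.
Proof. by rewrite dotC dotBr !(dotC w). Qed.

Lemma dot0r u : dot u 0 = 0.
Proof. by rewrite -(scale0r 0) dotZr mul0r. Qed.

Lemma coord_le_norm v i : `|v ord0 i| <= `|v|.
Proof.
rewrite [leRHS]/Num.norm /= mx_normrE.
by apply/bigmax_geP; right => /=; exists (ord0, i).
Qed.

Lemma dot_le_sum_norm u v : dot u v <= (\sum_i `|u ord0 i|) * `|v|.
Proof.
rewrite /dot mulr_suml; apply: ler_sum => i _.
rewrite (le_trans (ler_norm _))// normrM ler_wpM2l//.
exact: coord_le_norm.
Qed.

Lemma norm_le_norm2 v : `|v| <= norm2 v.
Proof.
have [->|v0] := eqVneq v 0; first by rewrite normr0 sqrtr_ge0.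
have /mx_norm_neq0[[i j] /= vE] : mx_norm v != 0.
  by rewrite -[mx_norm v]/`|v| normr_eq0.
rewrite -[`|v|]/(mx_norm v) vE -sqrtr_sqr ler_sqrt; last first.
  by apply: sumr_ge0 => k _; rewrite -expr2 sqr_ge0.
rewrite /dot (bigD1 j)//= ord1 -expr2 lerDl.
by apply: sumr_ge0 => k _; rewrite -expr2 sqr_ge0.
Qed.

(** Testing on [v = u] bounds [norm2 u ^+ 2] by [B * norm2 u]. *)
Lemma norm2_le_of_dot_le u (B : R) :
  0 <= B -> (forall v, dot u v <= B * `|v|) -> norm2 u <= B.
Proof.
move=> B0 uB.
have uu : dot u u = norm2 u ^+ 2.
  by rewrite sqr_sqrtr//; apply: sumr_ge0 => i _; rewrite -expr2 sqr_ge0.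
have [->//|u0] := eqVneq (norm2 u) 0.
have n0 : 0 < norm2 u by rewrite lt_neqAle eq_sym u0 sqrtr_ge0.
rewrite -(ler_pM2r n0) -expr2 -uu (le_trans (uB u))// ler_wpM2l//.
exact: norm_le_norm2.
Qed.

End DotProduct.

Section Norms.
Context {R : realType} {d : nat} {N : 'rV[R]_d -> R}.
Hypothesis hN : is_norm N.
Implicit Types (u v w x y : 'rV[R]_d) (a : R).

Let NZ : forall a x, N (a *: x) = `|a| * N x.
Proof. by case: hN. Qed.

Let ND : forall x y, N (x + y) <= N x + N y.
Proof. by case: hN. Qed.

Lemma is_norm0 : N 0 = 0.
Proof. by rewrite -(scale0r 0) NZ normr0 mul0r. Qed.

Lemma is_normN x : N (- x) = N x.
Proof. by rewrite -scaleN1r NZ normrN1 mul1r. Qed.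

Lemma is_norm_ge0 x : 0 <= N x.
Proof. by have := ND x (- x); rewrite subrr is_norm0 is_normN -mulr2n pmulrn_lge0. Qed.

Lemma is_norm_le_sup : exists K, forall x, N x <= K * `|x|.
Proof.
exists (\sum_i N (delta_mx ord0 i)) => x.
rewrite {1}[x]row_sum_delta mulr_suml.
have : N (\sum_(j < d) x ord0 j *: delta_mx ord0 j)
    <= \sum_(j < d) N (x ord0 j *: delta_mx ord0 j).
  elim/big_ind2 : _ => [|y a z b ya zb|//]; first by rewrite is_norm0.
  by rewrite (le_trans (ND _ _))// lerD.
move/le_trans; apply; apply: ler_sum => i _.
by rewrite NZ mulrC ler_wpM2l ?is_norm_ge0// coord_le_norm.
Qed.

Lemma is_norm_continuous : continuous N.
Proof.
have [K NK] := is_norm_le_sup => x.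
have NB y : `|N x - N y| <= K * `|x - y|.
  rewrite ler_norml; apply/andP; split.
    rewrite lerNl opprB lerBlDr.
    have := ND (y - x) x; rewrite subrK => /le_trans; apply.
    by rewrite lerD2r distrC.
  rewrite lerBlDr; have := ND (x - y) y; rewrite subrK => /le_trans; apply.
  by rewrite lerD2r.
have K1 : 0 < `|K| + 1 by rewrite ltr_wpDl.
apply/(@cvgrPdist_le _ _ _ _ (nbhs_filter x)) => e e0.
have : \forall y \near x, `|x - y| <= e / (`|K| + 1).
  have e1 : 0 < e / (`|K| + 1) by rewrite divr_gt0.
  exact: (@cvgr_dist_le _ _ _ _ (nbhs_filter x) id x (@cvg_id _ _) _ e1).
apply: filterS => y; rewrite ler_pdivlMr// mulrC; apply: le_trans.
rewrite (le_trans (NB y))// ler_wpM2r// (le_trans (ler_norm K))//.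
by rewrite lerDl.
Qed.

(** The minimum of [N] on the compact unit sphere of the sup norm is positive.
    With [is_norm_le_sup], this is the equivalence of norms in finite
    dimension. *)
Lemma is_norm_ge_sup : exists2 c, 0 < c & forall x, c * `|x| <= N x.
Proof.
pose S : set 'rV[R]_d := [set x | `|x| = 1].
have unit x : x != 0 -> S (`|x|^-1 *: x).
  by move=> x0; rewrite /S/= normrZ normfV normr_id mulVf// normr_eq0.
(* The sphere is empty in dimension 0. *)
have [S0|S0] := pselect (S !=set0); last first.
  exists 1 => // x; have [->|/unit Sx] := eqVneq x 0.
    by rewrite normr0 mulr0 is_norm0.
  by exfalso; apply: S0; eexists; exact: Sx.
have Sc : compact S.
  apply: bounded_closed_compact.
    by exists 1; split=> // M M1 x /= ->; exact: ltW.
  have /continuous_closedP := @norm_continuous _ 'rV[R]_d.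
  by move=> /(_ [set 1]); apply; exact: closed_eq.
have [c cS cmin] := EVT_min_rV S0 Sc (continuous_subspaceT is_norm_continuous).
have Sc1 : S c by rewrite inE in cS.
exists (N c) => [|x].
  rewrite lt_neqAle is_norm_ge0 andbT eq_sym; apply/eqP => Nc0.
  have c0 : c = 0 by case: hN => + _ _; exact.
  by move: Sc1; rewrite c0 /S/= normr0 => /esym/eqP; rewrite oner_eq0.
have [->|x0] := eqVneq x 0; first by rewrite normr0 mulr0 is_norm0.
have := cmin _ (mem_set (unit x x0)).
by rewrite NZ normfV normr_id ler_pdivlMl ?normr_gt0// mulrC.
Qed.

(** The supremum that defines [dual_norm N u] is a true upper bound because the
    unit ball of [N] is bounded. *)
Lemma dot_le_dual_norm u v : dot u v <= dual_norm N u * N v.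
Proof.
have [v0|v0] := eqVneq (N v) 0.
  have -> : v = 0 by case: hN => + _ _; exact.
  by rewrite dot0r is_norm0 mulr0.
have Nv0 : 0 < N v by rewrite lt_neqAle eq_sym v0 is_norm_ge0.
rewrite -ler_pdivrMr// mulrC -dotZr; apply: sup_upper_bound; last first.
  by exists ((N v)^-1 *: v) => //=; rewrite NZ normfV gtr0_norm// mulVf.
split; first by exists (dot u 0), 0 => //=; rewrite is_norm0.
have [c c0 cN] := is_norm_ge_sup.
exists ((\sum_i `|u ord0 i|) * c^-1) => _ [x /= Nx1 <-].
rewrite (le_trans (dot_le_sum_norm _ _))// ler_wpM2l//.
  by apply: sumr_ge0 => i _.
by rewrite -(mul1r c^-1) ler_pdivlMr// mulrC (le_trans (cN x)).
Qed.

End Norms.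

(** * Directional derivatives and convexity *)

Section DirectionalDerivatives.
Context {R : realType} {d : nat}.
Implicit Types (F : 'rV[R]_d -> R) (x y v w z : 'rV[R]_d) (s : R).

Lemma derive_dot F x v : differentiable F x -> 'D_v F x = dot (grad F x) v.
Proof.
move=> dF; rewrite deriveE// {1}[v]row_sum_delta linear_sum /dot.
by apply: eq_bigr => i _; rewrite linearZ /= mxE deriveE// mulrC.
Qed.

Lemma right_slope_cvg F x v : differentiable F x ->
  s^-1 * (F (x + s *: v) - F x) @[s --> 0^'+] --> dot (grad F x) v.
Proof.
move=> dF; rewrite -derive_dot//.
have /cvg_dnbhs_at_right := @diff_derivable _ _ _ F x v dF.
by apply: cvg_trans; apply: near_eq_cvg; near=> s; rewrite /= [_ + x]addrC.
Unshelve. all: by end_near. Qed.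

Lemma dot_grad_le_slope F x v (M : R) : differentiable F x ->
  (forall s, 0 < s < 1 -> F (x + s *: v) - F x <= s * M) ->
  dot (grad F x) v <= M.
Proof.
move=> dF FM; apply: (cvgr_to_le (right_slope_cvg dF)).
near=> s; have s0 : 0 < s by near: s; exact: nbhs_right_gt.
rewrite ler_pdivrMl// FM// s0 /=; near: s; exact: nbhs_right_lt.
Unshelve. all: by end_near. Qed.

Lemma dot_grad_ge_slope F x v (M : R) : differentiable F x ->
  (forall s, 0 < s < 1 -> s * M <= F (x + s *: v) - F x) ->
  M <= dot (grad F x) v.
Proof.
move=> dF FM; apply: (cvgr_to_ge (right_slope_cvg dF)).
near=> s; have s0 : 0 < s by near: s; exact: nbhs_right_gt.
rewrite ler_pdivlMl// FM// s0 /=; near: s; exact: nbhs_right_lt.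
Unshelve. all: by end_near. Qed.

Lemma is_derive_line F x v s : differentiable F (x + s *: v) ->
  is_derive s 1 (fun r => F (x + r *: v)) (dot (grad F (x + s *: v)) v).
Proof.
move=> dF; rewrite -derive_dot//.
have := @diff_derivable _ _ _ F (x + s *: v) v dF.
rewrite /derivable /derive.
under eq_fun => h do rewrite /= addrCA -scalerDl.
move=> dl; apply: DeriveDef.
  by rewrite /derivable; under eq_fun => h do rewrite /= [h *: 1]mulr1.
by rewrite /derive; under eq_fun => h do rewrite /= [h *: 1]mulr1.
Qed.

End DirectionalDerivatives.

Section Convexity.
Context {R : realType} {d : nat}.
Implicit Types (F : 'rV[R]_d -> R) (A : set 'rV[R]_d) (x y v w z : 'rV[R]_d).

Lemma conv_segmentE x y (s : R) : s *: y + (1 - s) *: x = x + s *: (y - x).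
Proof. by rewrite scalerBl scale1r scalerBr addrCA. Qed.

Lemma convex_set_segment A x y s : convex_set A -> A x -> A y ->
  0 <= s <= 1 -> A (x + s *: (y - x)).
Proof.
move=> cA Ax Ay /andP[s0 s1].
rewrite -conv_segmentE.
exact: (set_mem (cA y x (Itv01 s0 s1) (mem_set Ay) (mem_set Ax))).
Qed.

Lemma convex_function_segment A F x y s : convex_function A F -> A x -> A y ->
  0 <= s <= 1 -> F (x + s *: (y - x)) <= F x + s * (F y - F x).
Proof.
move=> cF Ax Ay /andP[s0 s1].
have : F (s *: y + (1 - s) *: x) <= s * F y + (1 - s) * F x.
  exact: (cF (Itv01 s0 s1) y x (mem_set Ay) (mem_set Ax)).
by rewrite conv_segmentE => /le_trans; apply; lra.
Qed.

(** The homothety of centre [z] and ratio [s] sends [A] into itself and a ball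
    around [w] onto a ball around [z + s *: (w - z)]. *)
Lemma segment_interior A z w s : convex_set A -> A z -> A° w ->
  0 < s <= 1 -> A° (z + s *: (w - z)).
Proof.
move=> cA Az /nbhs_ballP[e /= e0 wA] /andP[s0 s1].
apply/nbhs_ballP; exists (s * e); first exact: mulr_gt0.
move=> y; rewrite -ball_normE /= => ye.
have -> : y = z + s *: (z + s^-1 *: (y - z) - z).
  by rewrite (addrC z (s^-1 *: _)) addrK scalerA mulfV ?gt_eqF// scale1r addrC subrK.
apply: convex_set_segment => //; last by rewrite ltW.
apply: wA; rewrite -ball_normE /=.
have -> : w - (z + s^-1 *: (y - z)) = s^-1 *: (z + s *: (w - z) - y).
  rewrite [z + _ - y]addrAC (scalerDr _ (z - y)) scalerA mulVf ?gt_eqF// scale1r.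
  by rewrite -(opprB y z) scalerN opprD addrA [LHS]addrC.
by rewrite normrZ gtr0_norm ?invr_gt0// ltr_pdivrMl.
Qed.

Lemma convex_grad_le A F x y : convex_set A -> convex_function A F ->
  A x -> A y -> differentiable F x -> F x + dot (grad F x) (y - x) <= F y.
Proof.
move=> cA cF Ax Ay dF; rewrite -lerBrDl.
apply: dot_grad_le_slope => // s /andP[s0 s1].
by rewrite lerBlDl (convex_function_segment cF)// !ltW.
Qed.

(** The descent lemma.  Subtract from [F] along the segment the
    quadratic model [s * a + s ^+ 2 * b]: the difference has a nonpositive derivative, by
    the Lipschitz property of the gradient between [x] and [x + s *: (y - x)]. *)
Lemma smooth_descent N (L : R) A F x y : is_norm N -> smooth N L A F ->
  (forall s : R, 0 <= s <= 1 -> A (x + s *: (y - x))) ->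
  F y <= F x + dot (grad F x) (y - x) + L / 2 * N (y - x) ^+ 2.
Proof.
move=> hN [dF smF] Axy; set v := y - x; set a := dot _ v; set b := L / 2 * _.
pose g (s : R) := F (x + s *: v) - (s * a + s ^+ 2 * b).
pose dg (s : R) := dot (grad F (x + s *: v)) v - (a + 2 * s * b).
have gE (s : R) : 0 <= s <= 1 -> is_derive s 1 g (dg s).
  move=> s01; have dl := is_derive_line (dF _ (Axy _ s01)).
  have dq : is_derive s 1 ((id : R -> R) * cst a + (id : R -> R) ^+ 2 * cst b)
      (a + 2 * s * b).
    apply: is_derive_eq.
    by rewrite /GRing.scale/= !mulr0 !mulr1 !add0r expr1 (mulrC b).
  exact: is_deriveB.
have [||c] := @MVT _ g dg 0 1 ltr01.
- by move=> s; rewrite in_itv/= => /andP[s0 s1]; apply: gE; rewrite !ltW.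
- apply: derivable_within_continuous => s; rewrite in_itv/= => s01.
  by have [] := gE _ s01.
rewrite in_itv/= => /andP[c0 c1] gc.
have Ax : A x by have := Axy 0; rewrite scale0r addr0; apply; rewrite lexx ler01.
have Ac := Axy c; rewrite !ltW// in Ac.
have dgc : dg c <= 0.
  have := dot_le_dual_norm hN (grad F (x + c *: v) - grad F x) v.
  have /= := smF _ _ (Ac isT) Ax.
  rewrite addrAC subrr add0r dotBl -/a.
  have -> : N (c *: v) = c * N v by case: hN => _ -> _; rewrite gtr0_norm.
  have := is_norm_ge0 hN v; rewrite /dg /b; nra.
have xv : x + v = y by rewrite /v addrC subrK.
move: gc; rewrite /g scale1r scale0r addr0 xv; lra.
Qed.

End Convexity.

(** * Bregman divergence of an essentially smooth function *)

Section BregmanDivergence.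
Context {R : realType} {d : nat} {Omega : set 'rV[R]_d} {phi : 'rV[R]_d -> R}.
Implicit Types (x y v w z : 'rV[R]_d).
Hypothesis phi_grad_le : forall x y, Omega° x -> Omega y ->
  phi x + dot (grad phi x) (y - x) <= phi y.

Lemma bregman_ge0 x y : Omega x -> Omega° y -> 0 <= bregman phi x y.
Proof. by move=> Ox Oy; have := phi_grad_le Oy Ox; rewrite /bregman; lra. Qed.

Lemma bregmanxx x : bregman phi x x = 0.
Proof. by rewrite /bregman !subrr dot0r subrr. Qed.

(** Near the interior point [w], [phi] is at most [phi w + 1]; the gradient
    inequality at [y], tested at [w + (r / `|v|) *: v], turns this and the bound
    on [bregman phi w y] into a bound on the gradient at [y]. *)
Lemma bregman_le_grad_bounded w (M : R) : Omega° w -> differentiable phi w ->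
  exists2 B, 0 <= B & forall y, Omega° y -> bregman phi w y <= M ->
    forall v, dot (grad phi y) v <= B * `|v|.
Proof.
move=> Ow dw.
have : \forall x \near w, Omega x /\ phi x <= phi w + 1.
  apply: filterI; first exact: Ow.
  have /cvgr_dist_le/(_ _ ltr01) := differentiable_continuous dw.
  by apply: filterS => x; rewrite ler_norml => /andP[+ _]; lra.
move=> /nbhs_ballP[e /= e0 weP].
pose r := e / 2; have r0 : 0 < r by rewrite divr_gt0.
exists (`|M + 1| / r); first by rewrite divr_ge0// ltW.
move=> y Oy wyM v.
have [->|v0] := eqVneq v 0; first by rewrite dot0r normr0 mulr0.
have nv : 0 < `|v| by rewrite normr_gt0.
pose x := w + (r / `|v|) *: v.
have [Ox phix] : Omega x /\ phi x <= phi w + 1.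
  apply: weP; rewrite -ball_normE /= /x opprD addrA subrr sub0r normrN normrZ.
  rewrite gtr0_norm ?divr_gt0// divfK ?gt_eqF// /r; lra.
have := phi_grad_le Oy Ox.
rewrite /x addrAC dotDr dotZr => xy.
have : r / `|v| * dot (grad phi y) v <= `|M + 1|.
  rewrite (le_trans _ (ler_norm _))//; move: wyM; rewrite /bregman; lra.
by rewrite mulrAC ler_pdivrMr// mulrC -ler_pdivlMr// [leRHS]mulrAC.
Qed.

Hypothesis phi_smooth : essentially_smooth Omega phi.

(** The gradients at [y_ k] are bounded by [bregman_le_grad_bounded], whereas
    essential smoothness makes them blow up at boundary points. *)
Lemma bregman_bounded_limit_interior w z (y_ : nat -> 'rV[R]_d) (M : R) :
  Omega° w -> (forall k, Omega° (y_ k)) ->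
  (forall k, bregman phi w (y_ k) <= M) ->
  y_ k @[k --> \oo] --> z -> Omega z -> Omega° z.
Proof.
case: phi_smooth => _ dphi blowup Ow Oy wyM yz Oz; apply: contrapT => nOz.
have [B B0 gradB] := bregman_le_grad_bounded M Ow (dphi _ Ow).
have bz : boundary Omega z by split => //; exact: subset_closure.
have /cvgryPgt/(_ B) := blowup z y_ Oy bz yz.
case=> k _ /(_ k (leqnn k)) /=; rewrite ltNge => /negP; apply.
by apply: norm2_le_of_dot_le => // v; exact: gradB.
Qed.

(** The linear term [dot (grad phi (y_ k)) (z - y_ k)] vanishes in the limit
    because the gradients are bounded along the sequence, by
    [bregman_le_grad_bounded] with [w = z]. *)
Lemma bregman_cvg0 z (y_ : nat -> 'rV[R]_d) (M : R) :
  Omega° z -> (forall k, Omega° (y_ k)) ->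
  (forall k, bregman phi z (y_ k) <= M) ->
  y_ k @[k --> \oo] --> z -> bregman phi z (y_ k) @[k --> \oo] --> (0 : R).
Proof.
case: phi_smooth => _ dphi _ Oz Oy zyM yz.
have [B B0 gradB] := bregman_le_grad_bounded M Oz (dphi _ Oz).
have Oz' : Omega z by exact: interior_subset.
apply: (@squeeze_cvgr _ _ _ _ (cst 0)
    (fun k => phi z - phi (y_ k) + B * `|z - y_ k|)); last 2 first.
- exact: cvg_cst.
- rewrite -[X in _ --> X](addr0 0) -{1}(subrr (phi z)) -[X in _ + X](mulr0 B).
  apply: cvgD.
    apply: cvgB; first exact: cvg_cst.
    exact: (cvg_comp _ _ yz (differentiable_continuous (dphi _ Oz))).
  apply: cvgMr; rewrite -[X in _ --> X](@normr0 _ 'rV[R]_d) -(subrr z).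
  by apply: cvg_norm; apply: cvgB => //; exact: cvg_cst.
near=> k; rewrite bregman_ge0//=.
have := gradB _ (Oy k) (zyM k) (y_ k - z).
rewrite distrC -(opprB z) dotNr /bregman; lra.
Unshelve. all: by end_near. Qed.

End BregmanDivergence.

(** * Subsequences *)

Section Subsequences.
Context {R : realType} {d : nat}.

(** The extraction [m] need not be increasing: [k <= m k] already makes it tend
    to infinity. *)
Lemma bounded_subsequence (u : nat -> 'rV[R]_d) (B : R) :
  (forall k, `|u k| <= B) ->
  exists p : 'rV[R]_d, exists2 m : nat -> nat, forall k, (k <= m k)%N &
    u (m k) @[k --> \oo] --> p.
Proof.
move=> uB.
pose K := [set x : 'rV[R]_d | `|x| <= B].
have cK : compact K.
  apply: bounded_closed_compact.
    exists B; split; first exact: num_real.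
    by move=> M BM x /= xB; rewrite (le_trans xB)// ltW.
  have /continuous_closedP := @norm_continuous _ 'rV[R]_d.
  by move=> /(_ [set x | x <= B]); apply; exact: closed_le.
have [|p [_ pcl]] := cK (u @ \oo) _.
  by exists 0%N => // k _; exact: uB.
have /choice[m mP] (k : nat) : exists n, (k <= n)%N /\ `|p - u n| < k.+1%:R^-1.
  have k0 : 0 < k.+1%:R^-1 :> R by rewrite invr_gt0.
  have [|_ [[n kn <-] pn]] :=
      pcl [set u n | n in [set n | (k <= n)%N]] _ _ (nbhsx_ballx p _ k0).
    by exists k => // n /= kn; exists n.
  by exists n; split => //; move: pn; rewrite -ball_normE.
exists p, m => [k|]; first by have [] := mP k.
apply/cvgrPdist_lt => e e0; near=> k.
have [_ /lt_trans] := mP k; apply.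
near: k; have /cvgrPdist_lt/(_ e e0) := @cvg_harmonic R.
apply: filterS => k; rewrite sub0r normrN gtr0_norm//.
exact: harmonic_gt0.
Unshelve. all: by end_near. Qed.

Lemma nonincreasing_cvg0_subseq (u : nat -> R) (m : nat -> nat) :
  nonincreasing_seq u -> (forall t, 0 <= u t) ->
  u (m k) @[k --> \oo] --> (0 : R) -> u t @[t --> \oo] --> (0 : R).
Proof.
move=> u_dec u0 um.
apply/cvgrPdist_lt => e e0.
have /cvgrPdist_lt/(_ e e0)[k _ /(_ k (leqnn k))] := um.
rewrite /= sub0r normrN => mke.
exists (m k) => // t /= mkt; rewrite sub0r normrN ger0_norm// (le_lt_trans _ mke)//.
by rewrite (le_trans (u_dec _ _ mkt))// ler_norm.
Qed.

Lemma cvg_comp_nat (T : topologicalType) (u : nat -> T) (m : nat -> nat) (l : T) :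
  (forall k, (k <= m k)%N) -> u t @[t --> \oo] --> l ->
  u (m k) @[k --> \oo] --> l.
Proof.
move=> km ul; apply: (cvg_comp _ _ _ ul) => A [n _ nA].
by exists n => // k /= nk; apply: nA => /=; exact: leq_trans (km k).
Qed.

End Subsequences.

(** * The solution set *)

Section SolutionSet.
Context {R : realType} {d : nat} {C : set 'rV[R]_d} {f : 'rV[R]_d -> R}.
Implicit Types (x y s : 'rV[R]_d).
Local Notation S := (solution_set C f).

Lemma solution_le s x : S s -> C x -> f s <= f x.
Proof.
move=> [_ fs] Cx; rewrite -lee_fin fs; apply: ereal_inf_lbound; by exists x.
Qed.

Lemma le_solution s x : S s -> C x -> f x <= f s -> S x.
Proof.
move=> Ss Cx xs; split => //; case: (Ss) => _ <-; congr EFin.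
by apply/eqP; rewrite eq_le xs solution_le.
Qed.

Lemma closed_solution_set : closed C -> closed_on C f -> closed S.
Proof.
move=> clC /lower_semicontinuousP lscf.
have [->|/set0P[s Ss]] := eqVneq S set0; first exact: closed0.
suff -> : S =
    C `&` ~` [set x | ((f s)%:E < patch (cst +oo%E) C (EFin \o f) x)%E].
  by apply: closedI => //; exact: open_closedC.
apply/seteqP; split => x.
  move=> Sx; have Cx : C x by case: Sx.
  split=> //=; rewrite /patch mem_set//= lte_fin => /lt_geF.
  by rewrite (solution_le Sx (proj1 Ss)).
move=> [Cx]; rewrite /= /patch mem_set//= lte_fin => /negP; rewrite -leNgt.
exact: le_solution.
Qed.

Lemma convex_solution_set : convex_set C -> convex_function C f -> convex_set S.
Proof.
move=> cC cf x y l /set_mem Sx /set_mem Sy; apply: mem_set.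
have [Cx Cy] : C x /\ C y by case: Sx; case: Sy.
apply: (le_solution Sx).
  exact: (set_mem (cC x y l (mem_set Cx) (mem_set Cy))).
apply: (le_trans (cf l x y (mem_set Cx) (mem_set Cy))).
suff -> : f y = f x by rewrite convmm.
by apply/eqP; rewrite eq_le !solution_le.
Qed.

End SolutionSet.

(** * Mirror descent *)

Section MirrorDescent.
Context {R : realType} {d : nat} {Omega C : set 'rV[R]_d}.
Context {f phi N : 'rV[R]_d -> R} {L alpha : R}.
Context {eta : nat -> R} {theta : nat -> 'rV[R]_d}.
Implicit Types (x y u s w : 'rV[R]_d) (t : nat).

Hypothesis convex_Omega : convex_set Omega.
Hypothesis closed_C : closed C.
Hypothesis convex_C : convex_set C.
Hypothesis interior_C : C° !=set0.
Hypothesis C_Omega : C `<=` Omega.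
Hypothesis norm_N : is_norm N.
Hypothesis convex_f : convex_function C f.
Hypothesis L_gt0 : 0 < L.
Hypothesis smooth_f : smooth N L (C `&` Omega°) f.
Hypothesis smooth_phi : essentially_smooth Omega phi.
Hypothesis alpha_gt0 : 0 < alpha.
Hypothesis strong_phi : strongly_convex N alpha Omega phi.
Hypothesis theta0 : (C `&` Omega°) (theta 0%N).
Hypothesis eta_bound : forall t, 0 < eta t <= alpha / L.
Hypothesis theta_argmin : mirror_descent C f phi eta theta.

Local Notation S := (solution_set C f).
Local Notation D := (bregman phi).
Local Notation eta_diverges := ((\sum_(0 <= t <oo) (eta t)%:E)%E = +oo%E).

Let phi_diff x : Omega° x -> differentiable phi x.
Proof. by case: smooth_phi => _ + _; exact. Qed.

Let phi_grad_le x y : Omega° x -> Omega y ->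
  phi x + dot (grad phi x) (y - x) <= phi y.
Proof.
move=> Ox Oy; have := strong_phi Ox Oy.
by have := sqr_ge0 (N (x - y)); have := alpha_gt0; nra.
Qed.

Let strong_bregman x y : Omega x -> Omega° y ->
  alpha / 2 * N (x - y) ^+ 2 <= D x y.
Proof.
move=> Ox Oy; have := strong_phi Oy Ox.
by rewrite -(opprB x) is_normN// /bregman; lra.
Qed.

(** Optimality of [theta t.+1] against the points of a segment of [C]; the
    constant terms of the Bregman divergence cancel out. *)
Lemma argmin_segment t u (r : R) : C u -> 0 <= r <= 1 ->
  phi (theta t.+1) <= phi (theta t.+1 + r *: (u - theta t.+1)) +
    r * (eta t * dot (grad f (theta t)) (u - theta t.+1) -
         dot (grad phi (theta t)) (u - theta t.+1)).
Proof.
move=> Cu r01; have [Cz zmin] := theta_argmin t.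
have := zmin _ (convex_set_segment convex_C Cz Cu r01).
rewrite /bregman [_ + _ *: _ - theta t]addrAC !(dotDr _ _ (r *: _)) !dotZr; lra.
Qed.

(** Move from [z = theta t.+1] towards an interior point [w] of [C].  As [z] is
    optimal, [phi] cannot decrease from [z] faster than linearly, with some slope
    [- l].  This bounds the directional derivatives of [phi] at [y k] from below,
    hence bounds [D w (y k)] as [y k] tends to [z]. *)
Lemma argmin_interior t : Omega° (theta t) -> Omega° (theta t.+1).
Proof.
move=> Ox; have [Cz _] := theta_argmin t.
have [w Cw] := interior_C.
have Ow : Omega° w by exact: interiorS Cw.
set z := theta t.+1 in Cz *; have Oz : Omega z by exact: C_Omega.
pose s (k : nat) : R := k.+1%:R^-1.
have s01 k : 0 < s k <= 1 by rewrite invr_gt0 ltr0n/= invf_le1// ler1n.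
pose y k := z + s k *: (w - z).
have Oy k : Omega° (y k) by exact: segment_interior.
pose l := eta t * dot (grad f (theta t)) (w - z)
  - dot (grad phi (theta t)) (w - z).
apply: (@bregman_bounded_limit_interior _ _ _ _ phi_grad_le smooth_phi w z y
  (`|l| + `|dot (grad phi w) (w - z)|)) => // [k|].
  have /andP[sk0 sk1] := s01 k.
  have := @argmin_segment t w (s k) (interior_subset Cw).
  rewrite -/z -/l -/(y k) sk1 ltW// => /(_ isT) zmin.
  have zy : z - y k = - (s k *: (w - z)) by rewrite /y opprD addrA subrr sub0r.
  have wy : w - y k = (1 - s k) *: (w - z).
    by rewrite /y opprD addrA scalerBl scale1r.
  have := phi_grad_le (Oy k) Oz; rewrite zy dotNr dotZr => yz.
  have := phi_grad_le Ow (interior_subset (Oy k)).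
  rewrite -(opprB w) dotNr wy dotZr => wyk.
  rewrite /bregman wy dotZr.
  have gl : - dot (grad phi (y k)) (w - z) <= l.
    by rewrite -(ler_pM2l sk0); lra.
  have := ler_norm l; have := ler_norm (dot (grad phi w) (w - z)).
  have := normr_ge0 l; have := normr_ge0 (dot (grad phi w) (w - z)).
  nra.
rewrite -[X in _ --> X]addr0; apply: cvgD; first exact: cvg_cst.
rewrite -[X in _ --> X](scale0r (w - z)); apply: cvgZr_tmp.
exact: cvg_harmonic.
Qed.

Lemma iterates_feasible t : C (theta t) /\ Omega° (theta t).
Proof.
elim: t => [|t [_ Ot]]; first exact: theta0.
by split; [have [] := theta_argmin t | exact: argmin_interior].
Qed.

Let thetaC t : C (theta t). Proof. by have [] := iterates_feasible t. Qed.
Let thetaO t : Omega° (theta t). Proof. by have [] := iterates_feasible t. Qed.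

(** First-order optimality of [theta t.+1], in which
    [dot (grad phi z - grad phi x) (u - z)] has become the difference of
    divergences [D u x - D u z - D z x]. *)
Lemma bregman_three_point t u : C u ->
  eta t * dot (grad f (theta t)) (theta t.+1 - u) <=
  D u (theta t) - D u (theta t.+1) - D (theta t.+1) (theta t).
Proof.
move=> Cu; set z := theta t.+1; set x := theta t.
have : dot (grad phi x) (u - z) - eta t * dot (grad f x) (u - z)
    <= dot (grad phi z) (u - z).
  apply: dot_grad_ge_slope; first exact: phi_diff (thetaO _).
  move=> r /andP[r0 r1]; have r01 : 0 <= r <= 1 by rewrite !ltW.
  by have := argmin_segment t Cu r01; rewrite -/z -/x; lra.
rewrite /bregman -(opprB u z) dotNr.
have -> : u - x = (u - z) + (z - x) by rewrite addrA subrK.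
by rewrite (dotDr _ (u - z)); lra.
Qed.

(** The inequality from which everything follows.  The step size condition
    [eta t * L <= alpha] is what lets [D (theta t.+1) (theta t)] compensate for
    the quadratic term of the descent lemma. *)
Lemma mirror_descent_step t u : C u ->
  eta t * (f (theta t.+1) - f u) <= D u (theta t) - D u (theta t.+1).
Proof.
move=> Cu; have /andP[eta0 etaL] := eta_bound t.
have := bregman_three_point t Cu.
set z := theta t.+1; set x := theta t.
have df : differentiable f x.
  by case: smooth_f => + _; apply; exact: iterates_feasible.
have fxu := convex_grad_le convex_C convex_f (thetaC t) Cu df.
have fxz : f z <= f x + dot (grad f x) (z - x) + L / 2 * N (z - x) ^+ 2.
  apply: (smooth_descent norm_N smooth_f) => r r01; split.
    exact: (convex_set_segment convex_C (thetaC t) (thetaC t.+1)).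
  move: r01 => /andP[+ r1]; rewrite le_eqVlt => /predU1P[<-|r0].
    by rewrite scale0r addr0; exact: thetaO.
  apply: (segment_interior convex_Omega (C_Omega (thetaC t)) (thetaO t.+1)).
  by rewrite r0.
have Dzx := strong_bregman (C_Omega (thetaC t.+1)) (thetaO t).
rewrite -/x -/z in Dzx fxu.
have fuz : f z - f u <= dot (grad f x) (z - u) + L / 2 * N (z - x) ^+ 2.
  have -> : z - u = (z - x) - (u - x) by rewrite opprB addrA subrK.
  by rewrite dotBr; lra.
have etaL' : eta t * L <= alpha by rewrite -ler_pdivlMr.
have : eta t * (L / 2 * N (z - x) ^+ 2) <= alpha / 2 * N (z - x) ^+ 2.
  by rewrite mulrA ler_wpM2r ?sqr_ge0//; lra.
have : eta t * (f z - f u) <=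
    eta t * (dot (grad f x) (z - u) + L / 2 * N (z - x) ^+ 2).
  by rewrite ler_wpM2l// ltW.
lra.
Qed.

Lemma objective_nonincreasing : nonincreasing_seq (f \o theta).
Proof.
apply/nonincreasing_seqP => t /=.
have /andP[eta0 _] := eta_bound t.
rewrite -subr_le0 -(pmulr_rle0 _ eta0).
rewrite (le_trans (mirror_descent_step t (thetaC t)))// bregmanxx sub0r oppr_le0.
exact: (bregman_ge0 phi_grad_le (C_Omega (thetaC t)) (thetaO t.+1)).
Qed.

(** Telescoping of [mirror_descent_step]; each [f (theta t.+1)] is bounded below
    by the last value [f (theta T)]. *)
Lemma partial_sum_bound u (T : nat) : C u ->
  (\sum_(0 <= t < T) eta t) * (f (theta T) - f u) <=
  D u (theta 0%N) - D u (theta T).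
Proof.
move=> Cu; elim: T => [|T IH]; first by rewrite big_nil mul0r subrr.
rewrite big_nat_recr//= mulrDl.
have sum0 : 0 <= \sum_(0 <= t < T) eta t.
  by apply: sumr_ge0 => t _; have /andP[/ltW] := eta_bound t.
have fT : f (theta T.+1) <= f (theta T) by exact: objective_nonincreasing.
have := mirror_descent_step T Cu.
have := ler_wpM2l sum0 fT; lra.
Qed.

(** Otherwise every partial sum of the step sizes would be at most
    [D u (theta 0) / e]. *)
Lemma objective_below u (e : R) : eta_diverges -> C u -> 0 < e ->
  exists T, f (theta T) < f u + e.
Proof.
move=> eta_oo Cu e0; apply: contrapT => /forallNP fge.
suff : ((\sum_(0 <= t <oo) (eta t)%:E) <= (D u (theta 0%N) / e)%:E)%E.
  by rewrite eta_oo.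
apply: lime_le.
  apply: is_cvg_nneseries => t _ _; rewrite lee_fin.
  by have /andP[/ltW] := eta_bound t.
apply: nearW => T; rewrite sumEFin lee_fin ler_pdivlMr//.
have sum0 : 0 <= \sum_(0 <= t < T) eta t.
  by apply: sumr_ge0 => t _; have /andP[/ltW] := eta_bound t.
have eT : e <= f (theta T) - f u by have /negP := fge T; rewrite -leNgt; lra.
have := partial_sum_bound T Cu; have := ler_wpM2l sum0 eT.
have := bregman_ge0 phi_grad_le (C_Omega Cu) (thetaO T); lra.
Qed.

Lemma objective_cvg : eta_diverges ->
  (f (theta t))%:E @[t --> \oo] --> optimal_value C f.
Proof.
move=> eta_oo.
have -> : optimal_value C f = ereal_inf (range (fun t => (f (theta t))%:E)).
  apply/eqP; rewrite eq_le; apply/andP; split.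
    apply/ereal_infP => _ [t _ <-]; apply: ereal_inf_lbound.
    by exists (theta t).
  apply/ereal_infP => _ [u Cu <-]; apply/lee_addgt0Pr => e e0.
  have [T /ltW fT] := objective_below eta_oo Cu e0.
  apply: (@le_trans _ _ (f (theta T))%:E); last by rewrite -EFinD lee_fin.
  by apply: ereal_inf_lbound; exists T.
apply: ereal_nonincreasing_cvgn => m n mn.
by rewrite lee_fin; exact: objective_nonincreasing.
Qed.

Lemma bregman_nonincreasing s : S s ->
  nonincreasing_seq (fun t => D s (theta t)).
Proof.
move=> Ss; apply/nonincreasing_seqP => t.
have := mirror_descent_step t (proj1 Ss).
have := solution_le Ss (thetaC t.+1).
have /andP[eta0 _] := eta_bound t; nra.
Qed.

Lemma bregman_dist_nonincreasing : S !=set0 ->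
  nonincreasing_seq (fun t => bregman_dist phi S (theta t)).
Proof.
move=> S0 m n mn; rewrite /bregman_dist.
have [s Ss] := S0.
apply: lb_le_inf; first by exists (D s (theta m)), s.
move=> _ [u Su <-]; apply: le_trans (bregman_nonincreasing Su mn).
apply: ge_inf; last by exists u.
exists 0 => _ [v [Cv _] <-].
exact: (bregman_ge0 phi_grad_le (C_Omega Cv) (thetaO n)).
Qed.

Lemma iterates_bounded s : S s -> exists B, forall t, `|theta t| <= B.
Proof.
move=> Ss; have [c c0 cN] := is_norm_ge_sup norm_N.
exists (`|s| + (1 + D s (theta 0%N) / (alpha / 2)) / c) => t.
rewrite -(subrK s (theta t)) addrC (le_trans (ler_normD _ _))// lerD2l.
rewrite -normrN opprB ler_pdivlMr// mulrC (le_trans (cN _))//.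
have : N (s - theta t) ^+ 2 <= D s (theta 0%N) / (alpha / 2).
  rewrite ler_pdivlMr ?divr_gt0// mulrC.
  apply: (le_trans (strong_bregman (C_Omega (proj1 Ss)) (thetaO t))).
  exact: bregman_nonincreasing.
(* [n ^+ 2 <= q] implies [n <= 1 + q]. *)
set q := _ / _; set n := N _; nra.
Qed.

Lemma bregman_cvg0_iterates p : Omega p ->
  D p (theta t) @[t --> \oo] --> (0 : R) -> theta t @[t --> \oo] --> p.
Proof.
move=> Op Dp; have [c c0 cN] := is_norm_ge_sup norm_N.
apply/cvgrPdist_lt => e e0.
have ce0 : 0 < alpha / 2 * (c * e) ^+ 2.
  by rewrite mulr_gt0 ?divr_gt0// exprn_gt0// mulr_gt0.
have /cvgrPdist_lt/(_ _ ce0) := Dp; apply: filterS => t.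
rewrite sub0r normrN => /(le_lt_trans (ler_norm _)).
move=> /(le_lt_trans (strong_bregman Op (thetaO t))).
rewrite ltr_pM2l ?divr_gt0// ltr_pXn2r ?nnegrE ?is_norm_ge0//; last first.
  by rewrite mulr_ge0// ltW.
by move=> /(le_lt_trans (cN _)); rewrite ltr_pM2l.
Qed.

(** Take an accumulation point [p] of the iterates.  An interior solution forces
    [p] to be interior, and [f] and [phi] are then continuous at [p].  Otherwise
    lower semicontinuity of [f] makes [p] a solution, and the continuity of the
    divergence in its second argument gives the limit along the subsequence. *)
Lemma iterates_bregman_cvg : S !=set0 -> eta_diverges ->
  S `&` Omega° !=set0 \/ (bregman_continuous_snd Omega phi /\ closed_on C f) ->
  exists2 p, S p & D p (theta t) @[t --> \oo] --> (0 : R).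
Proof.
move=> [s0 Ss0] eta_oo cases.
have [B thetaB] := iterates_bounded Ss0.
have [p [m km mp]] := bounded_subsequence thetaB.
have Cp : C p by apply: (@closed_cvg _ _ _ _ _ C closed_C _ p mp); exact: nearW.
have fm s : S s -> f (theta (m k)) @[k --> \oo] --> f s.
  move=> [_ fs]; apply: (cvg_comp_nat (u := f \o theta)) => //.
  have := objective_cvg eta_oo; rewrite -fs => /fine_cvg; exact.
suff [Sp Dmp] : S p /\ D p (theta (m k)) @[k --> \oo] --> (0 : R).
  exists p => //.
  apply: (nonincreasing_cvg0_subseq (bregman_nonincreasing Sp) _ Dmp) => t.
  exact: (bregman_ge0 phi_grad_le (C_Omega Cp) (thetaO t)).
case: cases => [[s [Ss Os]]|[Dcont lscf]].
- have Op : Omega° p.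
    apply: (bregman_bounded_limit_interior phi_grad_le smooth_phi Os
      (y_ := theta \o m) (M := D s (theta 0%N)) _ _ mp (C_Omega Cp)) => k //=.
    exact: bregman_nonincreasing.
  have df : differentiable f p by case: smooth_f => + _; apply; split.
  have fp : f p = f s.
    have := cvg_comp _ _ mp (differentiable_continuous df).
    by move=> /cvg_unique; apply => //; exact: fm.
  have Sp : S p by apply: (le_solution Ss Cp); rewrite fp.
  split=> //; apply: (bregman_cvg0 phi_grad_le smooth_phi Op
    (y_ := theta \o m) (M := D p (theta 0%N)) _ _ mp) => k //=.
  exact: bregman_nonincreasing.
- split; last by apply: Dcont => // k; exact: thetaO.
  apply: (le_solution Ss0 Cp); rewrite leNgt; apply/negP => ltp.
  have ltp' : f s0 < (f s0 + f p) / 2 by lra.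
  have : ((((f s0 + f p) / 2)%:E) < patch (cst +oo%E) C (EFin \o f) p)%E.
    by rewrite /patch mem_set//= lte_fin; lra.
  move=> /lscf[V Vp ltV].
  suff : (f s0 + f p) / 2 <= f s0 by rewrite leNgt ltp'.
  apply: (cvgr_to_ge (fm _ Ss0)).
  have : \forall k \near \oo, V (theta (m k)) by exact: mp Vp.
  apply: filterS => k /ltV.
  by rewrite /patch mem_set//= lte_fin; exact: ltW.
Qed.

(** The terms [phi u] cancel out, so that [a u] below is affine in [u]; it is
    nonpositive on [S], and an affine function that is bounded above on an affine
    set is constant. *)
Lemma bregman_gap_constant t u v : affine_set S -> S u -> S v ->
  D u (theta t) - D u (theta 0%N) = D v (theta t) - D v (theta 0%N).
Proof.
move=> affS.
pose a x := D x (theta t) - D x (theta 0%N).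
have a_aff x y (r : R) : a (r *: x + (1 - r) *: y) = a y + r * (a x - a y).
  rewrite [_ + _ *: _]conv_segmentE /a /bregman.
  rewrite ![_ + r *: _ - _]addrAC !(dotDr _ _ (r *: _)) !dotZr !dotBr; lra.
have a_le0 x : S x -> a x <= 0.
  by move=> Sx; rewrite /a subr_le0; exact: bregman_nonincreasing.
have a_mono x y : S x -> S y -> a x <= a y.
  move=> Sx Sy; rewrite leNgt; apply/negP => yx.
  (* the point of the line through [x] and [y] where [a] takes the value 1 *)
  pose r := (1 - a y) / (a x - a y).
  have := a_le0 _ (affS x y r Sx Sy).
  by rewrite a_aff /r divfK ?subr_eq0 ?gt_eqF//; lra.
by move=> Su Sv; apply/eqP; rewrite eq_le !a_mono.
Qed.

(** Since the gap is constant in time,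
    [D u (theta 0) - D p (theta 0) = D u (theta t) - D p (theta t)], whose limit
    inferior is nonnegative.  If [u] is another minimizer, the left-hand side
    vanishes, so [D u (theta t)] tends to 0 and the iterates converge to [u]. *)
Lemma bregman_proj_limit p : affine_set S -> S p ->
  D p (theta t) @[t --> \oo] --> (0 : R) ->
  bregman_proj phi S (theta 0%N) = [set p].
Proof.
move=> affS Sp Dp; have Dge0 u t : S u -> 0 <= D u (theta t).
  by move=> [Cu _]; exact: (bregman_ge0 phi_grad_le (C_Omega Cu) (thetaO t)).
apply/seteqP; split => [q [Sq qmin]|_ ->].
  have Dq : D q (theta t) @[t --> \oo] --> (0 : R).
    apply: (@squeeze_cvgr _ _ _ _ (cst 0) (fun t => D p (theta t))) => //.
      apply: nearW => t; rewrite Dge0//=.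
      have := bregman_gap_constant t affS Sq Sp; have := qmin _ Sp; lra.
    exact: cvg_cst.
  have qp := bregman_cvg0_iterates (C_Omega (proj1 Sq)) Dq.
  have pp := bregman_cvg0_iterates (C_Omega (proj1 Sp)) Dp.
  by apply: (cvg_unique _ qp pp).
split=> // u Su.
have gap_cvg : D u (theta 0%N) - D p (theta 0%N) + D p (theta t) @[t --> \oo]
    --> D u (theta 0%N) - D p (theta 0%N).
  by rewrite -[X in _ --> X]addr0; apply: cvgD => //; exact: cvg_cst.
rewrite -subr_ge0; apply: (cvgr_to_ge gap_cvg).
apply: nearW => t; have := bregman_gap_constant t affS Su Sp.
have := Dge0 u t Su; lra.
Qed.

End MirrorDescent.

Unset Implicit Arguments.

Theorem corollary5 (R : realType) (d : nat) (Omega C : set 'rV[R]_d)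
    (f phi N : 'rV[R]_d -> R) (L alpha : R)
    (eta : nat -> R) (theta : nat -> 'rV[R]_d) :
  closed Omega -> convex_set Omega -> Omega° !=set0 ->
  closed C -> convex_set C -> C° !=set0 ->
  C `<=` Omega ->
  is_norm N ->
  convex_function C f ->
  0 < L -> smooth N L (C `&` Omega°) f ->
  legendre Omega phi ->
  0 < alpha -> strongly_convex N alpha Omega phi ->
  (C `&` Omega°) (theta 0%N) ->
  (forall t, 0 < eta t <= alpha / L) ->
  mirror_descent C f phi eta theta ->
  let fstar := optimal_value C f in
  let S := solution_set C f in
  let eta_diverges := (\sum_(0 <= t <oo) (eta t)%:E = +oo)%E in
  [/\ (* objective convergence *)
      eta_diverges -> (f (theta t))%:E @[t --> \oo] --> fstar,
      (* nonincreasing distance to the solution set; closed_on C f only serves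
         the closedness of S *)
      [/\ closed_on C f -> closed S,
          convex_set S &
          S !=set0 ->
            (forall s, S s ->
               nonincreasing_seq (fun t => bregman phi s (theta t))) /\
            nonincreasing_seq (fun t => bregman_dist phi S (theta t))],
      (* iterate convergence *)
      S !=set0 -> eta_diverges ->
        S `&` Omega° !=set0 \/
        (bregman_continuous_snd Omega phi /\ closed_on C f) ->
        exists2 theta_oo, S theta_oo & theta t @[t --> \oo] --> theta_oo &
      (* minimum Bregman divergence solution *)
      S !=set0 -> eta_diverges -> affine_set S -> S `<=` Omega° ->
        exists2 theta_oo, theta t @[t --> \oo] --> theta_oo &
          bregman_proj phi S (theta 0%N) = [set theta_oo]].
Proof.
move=> clO cO O0 clC cC C0 CO hN cf L0 sf [_ sphi _] a0 strphi th0 etaP thP.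
move=> fstar S eta_diverges.
have limit_cvg := bregman_cvg0_iterates cO cC C0 CO hN sphi a0 strphi th0 thP.
have limit_ex := iterates_bregman_cvg
  cO clC cC C0 CO hN cf L0 sf sphi a0 strphi th0 etaP thP.
split.
- exact: (objective_cvg cO cC C0 CO hN cf L0 sf sphi a0 strphi th0 etaP thP).
- split.
  + exact: closed_solution_set.
  + exact: convex_solution_set.
  + move=> S0; split.
      exact: (bregman_nonincreasing
        cO cC C0 CO hN cf L0 sf sphi a0 strphi th0 etaP thP).
    exact: (bregman_dist_nonincreasing
      cO cC C0 CO hN cf L0 sf sphi a0 strphi th0 etaP thP).
- move=> S0 eta_oo cases; have [p Sp Dp] := limit_ex S0 eta_oo cases.
  by exists p => //; apply: limit_cvg Dp; apply: CO; case: Sp.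
- move=> S0 eta_oo affS SO.
  have [|p Sp Dp] := limit_ex S0 eta_oo.
    by left; have [s Ss] := S0; exists s; split => //; exact: SO.
  exists p; first by apply: limit_cvg Dp; apply: CO; case: Sp.
  exact: (bregman_proj_limit
    cO cC C0 CO hN cf L0 sf sphi a0 strphi th0 etaP thP).
Qed.
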